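(* For all $n\ge1$, let $\varphi_0^n(x):=(1-n|x|)^+$ for $x\in\mathbb{R}^d$, and let $\varphi_n$ be the viscosity solution of $$\partial_t\varphi=\sum_{i=1}^d|\partial_{x_i}\varphi|\quad\text{in }\mathbb{R}^d\times(0,\infty)$$ with initial data $\varphi_0^n$. Then $\varphi_0^n\in C_b\cap L^\infty_{\mathrm{int}}(\mathbb{R}^d)$ and $$\lim_{n\to\infty}\varphi_0^n=0\quad\text{in }L^1(\mathbb{R}^d),$$ but $$\lim_{n\to\infty}\varphi_n(\cdot,t)=\mathbf{1}_{\overline{Q}_t}(\cdot)\ne0\quad\text{in }L^1(\mathbb{R}^d),\quad\forall t>0.$$
   Context: $C_b$ denotes bounded continuous functions, $r^+=\max\{r,0\}$, $\mathbb{R}^+=[0,\infty)$, $\overline{Q}_1(x)=x+[-1,1]^d$, $\overline{Q}_t=[-t,t]^d$, and $\mathbf{1}_U$ is the indicator function of $U$. $L^\infty_{\mathrm{int}}(\mathbb{R}^d)=\{f\in L^1_{\mathrm{loc}}(\mathbb{R}^d):\int_{\mathbb{R}^d}\operatorname{ess\,sup}_{\overline{Q}_1(x)}|f|\,dx<\infty\}$. The viscosity solution with initial data $\varphi_0\in C_b(\mathbb{R}^d)$ is the unique $\varphi\in C_b(\mathbb{R}^d\times\mathbb{R}^+)$ with $\varphi(\cdot,0)=\varphi_0$ such that, for every $\phi\in C^\infty(\mathbb{R}^d\times\mathbb{R}^+)$ and $(x,t)\in\mathbb{R}^d\times(0,\infty)$, $\partial_t\phi(x,t)\le\sum_i|\partial_{x_i}\phi(x,t)|$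 if $(x,t)$ is a local maximum of $\varphi-\phi$, and $\ge$ if it is a local minimum of $\varphi-\phi$. *)

(* Defs.v *)
From HB Require Import structures.
From mathcomp Require Import all_boot all_order all_algebra.
From mathcomp Require Import all_classical all_reals all_analysis.

Set Implicit Arguments.
Unset Strict Implicit.
Unset Printing Implicit Defensive.

Import Order.TTheory GRing.Theory Num.Theory.
Import numFieldNormedType.Exports.

Local Open Scope classical_set_scope.
Local Open Scope ring_scope.

(* Points of R^d are row vectors 'rV[R]_d.  The library topology on 'rV[R]_d
   comes from the sup norm; the sigma-algebra below, generated by the
   coordinates, is the Borel one. *)

Definition rV_display : measure_display.
Proof. exact: default_measure_display. Qed.

Section measurable_rV.
Context {R : realType} (d : nat).

Let coord (i : 'I_d) (x : 'rV[R]_d) : measurableTypeR R := x ord0 i.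

Let rV_set0 : g_sigma_preimage coord set0.
Proof. exact: sigma_algebra0. Qed.

Let rV_setC A : g_sigma_preimage coord A -> g_sigma_preimage coord (~` A).
Proof. exact: sigma_algebraC. Qed.

Let rV_bigcup (F : (set 'rV[R]_d)^nat) : (forall i, g_sigma_preimage coord (F i)) ->
  g_sigma_preimage coord (\bigcup_i (F i)).
Proof. exact: sigma_algebra_bigcup. Qed.

HB.instance Definition _ := @isMeasurable.Build rV_display
  'rV[R]_d (g_sigma_preimage coord) rV_set0 rV_setC rV_bigcup.

End measurable_rV.

Lemma measurable_coord (R : realType) d (i : 'I_d) :
  measurable_fun [set: 'rV[R]_d]
    (fun x : 'rV[R]_d => x ord0 i : measurableTypeR R).
Proof.
move=> _ Y mY; rewrite setTI; apply: sub_sigma_algebra => /=.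
rewrite -bigcup_seq/=; exists i => /=; first by rewrite mem_index_enum.
by exists Y => //; rewrite setTI.
Qed.

Lemma measurable_fun_coord d1 (T : measurableType d1) (R : realType) d
    (f : T -> 'rV[R]_d) :
  (forall i, measurable_fun setT (fun x => f x ord0 i : measurableTypeR R)) ->
  measurable_fun setT f.
Proof.
move=> mf _ Y mY; rewrite setTI.
suff : measurable `<=` [set A | measurable (f @^-1` A)] by exact.
apply: smallest_sub.
  split => /=; first by rewrite preimage_set0.
  - by move=> A mA; rewrite setTD preimage_setC; exact: measurableC.
  - by move=> F mF; rewrite preimage_bigcup; exact: bigcup_measurable.
rewrite -bigcup_seq => A [i _ [B mB <-]] /=.
by rewrite setTI; have := mf i measurableT B mB; rewrite setTI.
Qed.

Section lebesgue_rV.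
Context {R : realType}.

Definition cons_rV d (p : measurableTypeR R * 'rV[R]_d) : 'rV[R]_d.+1 :=
  row_mx (const_mx p.1 : 'rV[R]_1) p.2.

Lemma measurable_cons_rV d : measurable_fun setT (@cons_rV d).
Proof.
apply: measurable_fun_coord => i.
have [j|j] := splitP (i : 'I_(1 + d)) => ij.
  have -> : i = lshift d j by exact/val_inj.
  rewrite (_ : (fun _ => _) = fst)//; apply/funext => p.
  by apply: etrans (row_mxEl _ _ _ _) _; rewrite mxE.
have -> : i = rshift 1 j by exact/val_inj.
rewrite (_ : (fun _ => _) =
  (fun x : 'rV[R]_d => x ord0 j : measurableTypeR R) \o snd).
  by apply: measurableT_comp => //; exact: measurable_coord.
by apply/funext => p; exact: row_mxEr.
Qed.

Section step.
Variables (d : nat) (mu : {sigma_finite_measure set 'rV[R]_d -> \bar R}).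

Definition lebesgue_rVS : set 'rV[R]_d.+1 -> \bar R :=
  pushforward (lebesgue_measure \x mu)%E (@cons_rV d).

Let lebesgue_rVS0 : lebesgue_rVS set0 = 0%E.
Proof. by rewrite /lebesgue_rVS /pushforward preimage_set0 measure0. Qed.

Let lebesgue_rVS_ge0 A : (0 <= lebesgue_rVS A)%E.
Proof. by apply: integral_ge0 => x _; exact: measure_ge0. Qed.

Let preimage_cons_rV A : measurable A -> measurable (@cons_rV d @^-1` A).
Proof.
by move=> mA; rewrite -[X in measurable X]setTI; exact: measurable_cons_rV.
Qed.

Let lebesgue_rVS_sigma_additive : semi_sigma_additive lebesgue_rVS.
Proof.
move=> F mF tF mUF; rewrite /lebesgue_rVS /pushforward preimage_bigcup.
apply: measure_semi_sigma_additive.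
- by move=> n; exact: preimage_cons_rV.
- apply/trivIsetP => /= i j _ _ ij; rewrite -preimage_setI.
  by move/trivIsetP : tF => /(_ _ _ _ _ ij) ->//; rewrite preimage_set0.
- by rewrite -preimage_bigcup; exact: preimage_cons_rV.
Qed.

HB.instance Definition _ := isMeasure.Build _ _ _ lebesgue_rVS
  lebesgue_rVS0 lebesgue_rVS_ge0 lebesgue_rVS_sigma_additive.

Let lebesgue_rVS_sigma_finite : sigma_finite setT lebesgue_rVS.
Proof.
have /sigma_finiteP[F [FT ndF F_fin]] := sigma_finiteT (@lebesgue_measure R).
have /sigma_finiteP[G [GT ndG G_fin]] := sigma_finiteT mu.
pose uncons (x : 'rV[R]_d.+1) : measurableTypeR R * 'rV[R]_d :=
  (x ord0 ord0, rsubmx (x : 'rV_(1 + d))).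
have consK : cancel (@cons_rV d) uncons.
  move=> [a y]; congr pair; last exact: row_mxKr.
  have e : @ord0 d = lshift d (@ord0 0) by exact/val_inj.
  rewrite -[LHS]/(cons_rV (a, y) ord0 (@ord0 d)) e.
  by apply: etrans (row_mxEl _ _ _ _) _; rewrite mxE.
have munc : measurable_fun setT uncons.
  apply/measurable_fun_pairP; split; first exact: measurable_coord.
  apply: measurable_fun_coord => i.
  rewrite (_ : (fun _ => _) = fun x : 'rV[R]_d.+1 =>
      x ord0 (rshift 1 i : 'I_d.+1) : measurableTypeR R).
    exact: measurable_coord.
  by apply/funext => x; rewrite mxE.
exists (fun n => uncons @^-1` (F n `*` G n)).
  apply/esym; rewrite -subTset => x _.
  have [i _ Fi] : (\bigcup_i F i) (uncons x).1 by rewrite -FT.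
  have [j _ Gj] : (\bigcup_j G j) (uncons x).2 by rewrite -GT.
  exists (maxn i j) => //; split.
  - by move: Fi; exact/subsetPset/ndF/leq_maxl.
  - by move: Gj; exact/subsetPset/ndG/leq_maxr.
move=> n; have [mF Foo] := F_fin n; have [mG Goo] := G_fin n; split.
  by rewrite -[X in measurable X]setTI; apply: munc => //; exact: measurableX.
rewrite /lebesgue_rVS /pushforward -comp_preimage (_ : _ \o _ = id); last first.
  by apply/funext => p; exact: consK.
by rewrite preimage_id product_measure1E// lte_mul_pinfty// ge0_fin_numE.
Qed.

HB.instance Definition _ := Measure_isSigmaFinite.Build _ _ _ lebesgue_rVS
  lebesgue_rVS_sigma_finite.

End step.

Fixpoint lebesgue_rV (d : nat) : {sigma_finite_measure set 'rV[R]_d -> \bar R} :=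
  match d with
  | 0%N => \d_(0 : 'rV[R]_0)
  | d'.+1 => lebesgue_rVS (lebesgue_rV d')
  end.

End lebesgue_rV.

(* Under the identification R^(d+1) = R x R^d, the measure in dimension d+1 is
   the product of the library's one-dimensional Lebesgue measure and of the
   measure in dimension d; the following lemma pins it down on boxes. *)
Lemma lebesgue_rV_box (R : realType) d (A : 'I_d -> set (measurableTypeR R)) :
  (forall i, measurable (A i)) ->
  lebesgue_rV d [set x | forall i, A i (x ord0 i)] =
  (\prod_(i < d) lebesgue_measure (A i))%E.
Proof.
elim: d A => [|d IH] A mA.
  rewrite big_ord0 /= diracE mem_set//= => -[].
  by [].
have mbox : measurable [set x : 'rV[R]_d | forall i, A (lift ord0 i) (x ord0 i)].
  rewrite (_ : [set _ | _] = \bigcap_(i in setT)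
      ((fun x : 'rV[R]_d => x ord0 i : measurableTypeR R) @^-1` A (lift ord0 i))).
    apply: fin_bigcap_measurable => // i _.
    by rewrite -[X in measurable X]setTI; exact: measurable_coord.
  by apply/seteqP; split=> x /= Ax i => [_|]; exact: Ax.
rewrite big_ord_recl -IH// -product_measure1E//.
rewrite -[LHS]/((lebesgue_measure \x lebesgue_rV d)%E _); congr (_ _).
have e0 : @ord0 d = lshift d (@ord0 0) by exact/val_inj.
have eS i : lift ord0 i = rshift 1 i :> 'I_d.+1 by exact/val_inj.
have c0 p : cons_rV p ord0 (@ord0 d) = p.1 :> R.
  by rewrite e0; apply: etrans (row_mxEl _ _ _ _) _; rewrite mxE.
have cS (p : measurableTypeR R * 'rV[R]_d) i :
    cons_rV p ord0 (lift ord0 i) = p.2 ord0 i.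
  by rewrite eS; exact: row_mxEr.
apply/seteqP; split=> [p /= Ap|p /= [A0 AS] i].
  by split=> [|i]; [rewrite -c0|rewrite -cS].
by have [j|] := unliftP ord0 i => ->; rewrite ?c0 ?cS.
Qed.

Section euclidean.
Context {R : realType} {d : nat}.
Implicit Types (f : 'rV[R]_d -> R) (x : 'rV[R]_d).

(* `|x| is the sup norm of the library, so the Euclidean norm is spelled out. *)
Definition enorm x : R := Num.sqrt (\sum_(i < d) x ord0 i ^+ 2).

(* x + [-r, r]^d *)
Definition cube (r : R) x : set 'rV[R]_d :=
  [set y | forall i, `|y ord0 i - x ord0 i| <= r].

Local Notation leb := (lebesgue_rV d).

Definition ess_sup_in (D : set 'rV[R]_d) (g : 'rV[R]_d -> \bar R) : \bar R :=
  ereal_inf [set M | \forall y \ae leb, D y -> (g y <= M)%E].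

(* Real-valued Borel representatives stand for classes modulo a.e. equality. *)
Definition L1loc f :=
  measurable_fun setT f /\
  forall K : set 'rV[R]_d, compact K ->
    (\int[leb]_(x in K) `|f x|%:E < +oo)%E.

Definition Linf_int f :=
  L1loc f /\
  (\int[leb]_x ess_sup_in (cube 1 x) (fun y => `|f y|%:E) < +oo)%E.

Definition L1_cvg (f : nat -> 'rV[R]_d -> R) (g : 'rV[R]_d -> R) :=
  [/\ forall n, leb.-integrable setT (EFin \o f n),
      leb.-integrable setT (EFin \o g) &
      (fun n => 'N[leb]_1[EFin \o (f n \- g)%R])%E @ \oo --> 0%E].

End euclidean.

Definition Cb {R : realType} {T : topologicalType} (D : set T) (f : T -> R) :=
  {within D, continuous f} /\ [bounded f z | z in D].

Section viscosity.
Context {R : realType} {d : nat}.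
Implicit Types psi phi : 'rV[R]_d * R -> R.

Definition halfspace : set ('rV[R]_d * R) := [set z | 0 <= z.2].

Definition dt : 'rV[R]_d * R := (0, 1).
Definition dx (i : 'I_d) : 'rV[R]_d * R := (delta_mx ord0 i, 0).

Definition dirs : seq ('rV[R]_d * R) := dt :: [seq dx i | i : 'I_d].

(* C^oo on R^d x R: every iterated partial derivative, in every order of the
   variables, exists and is continuous.  The restrictions of these functions to
   R^d x [0, +oo) are the smooth functions on that closed half-space. *)
Definition smooth psi :=
  forall (s : seq ('rV[R]_d * R)), {subset s <= dirs} ->
    let psi_s := foldr (fun v g => 'D_v g) psi s in
    continuous psi_s /\
    forall v, v \in dirs -> forall z, derivable psi_s z v.

Definition local_max_at (D : set ('rV[R]_d * R)) (g : 'rV[R]_d * R -> R) z :=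
  \forall z' \near z, D z' -> g z' <= g z.

Definition local_min_at (D : set ('rV[R]_d * R)) (g : 'rV[R]_d * R -> R) z :=
  \forall z' \near z, D z' -> g z <= g z'.

(* Values of phi at negative times are irrelevant: its continuity and bound, and
   the comparisons defining local extrema, only involve the half-space. *)
Definition viscosity_solution (phi0 : 'rV[R]_d -> R) phi :=
  [/\ Cb halfspace phi,
      forall x, phi (x, 0) = phi0 x &
      forall psi, smooth psi -> forall (x : 'rV[R]_d) (t : R), 0 < t ->
        (local_max_at halfspace (phi \- psi) (x, t) ->
          'D_dt psi (x, t) <= \sum_(i < d) `|'D_(dx i) psi (x, t)|) /\
        (local_min_at halfspace (phi \- psi) (x, t) ->
          'D_dt psi (x, t) >= \sum_(i < d) `|'D_(dx i) psi (x, t)|)].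

Definition hat (n : nat) (x : 'rV[R]_d) : R :=
  Num.max (1 - n%:R * enorm x) 0.

End viscosity.

(* Main.v *)
Require Import Defs.
From mathcomp Require Import all_boot all_order all_algebra.
From mathcomp Require Import all_classical all_reals all_analysis.
From mathcomp Require Import measurable_realfun ring lra.

Import Order.TTheory GRing.Theory Num.Theory.
Import numFieldNormedType.Exports.

Local Open Scope classical_set_scope.
Local Open Scope ring_scope.

(** Each solution is squeezed between explicit smooth barriers; neither a
    general comparison principle nor a representation formula is used.

    Comparison with a smooth barrier.  Let [phi] be a viscosity solution and [w]
    a smooth function with [D_t w >= sum_i |D_i w|], bounded below on the
    half-space [t >= 0] and above [phi] at [t = 0].  Put
    [p (x, t) = exp ((d + 1) t) (1 + |x|^2)], a strict supersolution that tends
    to infinity at infinity of the half-space.  For [e > 0] the function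
    [phi - (w + e p)] has a global maximum on the closed half-space; if it were
    positive, it would be attained at a positive time, where the definition of
    viscosity solutions contradicts the strict inequality for [w + e p].
    Letting [e] tend to 0 gives [phi <= w] ([viscosity_le_supersolution]), and
    the same argument with the opposite signs handles subsolutions
    ([viscosity_ge_subsolution]).

    Barriers.  They are all built from the coordinates by sums, products and
    the exponential, hence smooth ([exppoly_smooth]).  Let [phi] be the solution
    with initial data [(1 - n |x|)^+].
    - The constants 0 and 1 give [0 <= phi <= 1].
    - The plane waves [exp (k (t + s x_i + 1/n))], with [k >= 0] and [s = 1] or
      [s = -1], solve the equation and dominate the initial data.  As [k] tends
      to infinity they give [phi (x, t) = 0] when some [|x_i| > t + 1/n]
      ([sol_eq0]).
    - The travelling paraboloid [1 - e - n^2 / (4 e) |y - s x / t|^2], in the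
      variables [(y, s)], is a subsolution as soon as all [|x_i| <= t], because
      its velocity [x / t] then has all its coordinates in [[-1, 1]].  It lies
      below the initial data, and its value at [(x, t)] is [1 - e]; hence
      [phi (x, t) = 1] ([sol_eq1]).

    Consequently [phi (., t)] differs from the indicator of the cube
    [[-t, t]^d] by at most the indicator of
    [[-t-1/n, t+1/n]^d \ [-t, t]^d], whose measure tends to 0.  The initial
    data are likewise bounded by the indicator of [[-1/n, 1/n]^d]. *)

(** * Exponential polynomials *)

Section exppoly.
Context {R : realType} {d : nat}.
Local Notation V := ('rV[R]_d * R)%type.
Implicit Types (f g : V -> R) (z v : V).

(** The space coordinates and the time coordinate, as functions on R^d x R. *)
Definition xcoord (i : 'I_d) : V -> R := fun z => z.1 ord0 i.
Definition tcoord : V -> R := snd.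

(** Functions built from constants and coordinates by sums, products and
    exponentials.  The class is closed under directional derivatives, whence the
    smoothness of its members. *)
Inductive exppoly : (V -> R) -> Prop :=
| exppoly_cst c : exppoly (cst c)
| exppoly_x i : exppoly (xcoord i)
| exppoly_t : exppoly tcoord
| exppolyD f g : exppoly f -> exppoly g -> exppoly (f + g)
| exppolyM f g : exppoly f -> exppoly g -> exppoly (f * g)
| exppoly_exp f : exppoly f -> exppoly (expR \o f).

Lemma differentiable_xcoord i z : differentiable (xcoord i) z.
Proof.
apply: (@differentiable_comp _ _ _ _ fst (fun x : 'rV[R]_d => x ord0 i)).
  apply: linear_differentiable => p; exact: cvg_fst.
exact: differentiable_coord.
Qed.

Lemma differentiable_tcoord z : differentiable tcoord z.
Proof. by apply: linear_differentiable => p; exact: cvg_snd. Qed.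

Lemma differentiable_expR (r : R) : differentiable expR r.
Proof. by apply/derivable1_diffP; exact: derivable_expR. Qed.

Lemma exppoly_differentiable f z : exppoly f -> differentiable f z.
Proof.
elim=> {f} [c|i||f g _ df _ dg|f g _ df _ dg|f _ df].
- exact: differentiable_cst.
- exact: differentiable_xcoord.
- exact: differentiable_tcoord.
- exact: differentiableD.
- exact: differentiableM.
- by apply: differentiable_comp => //; exact: differentiable_expR.
Qed.

#[local] Instance is_derive_xcoord i z v : is_derive z v (xcoord i) (v.1 ord0 i).
Proof.
apply: DeriveDef; first exact/diff_derivable/differentiable_xcoord.
rewrite /derive; apply: cvg_lim => //.
apply: cvg_near_cst; near=> h.
have h0 : h != 0 by near: h; exact: nbhs_dnbhs_neq.
by rewrite /xcoord /= !mxE addrK scalerA mulVf// scale1r.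
Unshelve. all: by end_near. Qed.

#[local] Instance is_derive_tcoord z v : is_derive z v tcoord v.2.
Proof.
apply: DeriveDef; first exact/diff_derivable/differentiable_tcoord.
rewrite /derive; apply: cvg_lim => //.
apply: cvg_near_cst; near=> h.
have h0 : h != 0 by near: h; exact: nbhs_dnbhs_neq.
by rewrite /tcoord /= addrK scalerA mulVf// scale1r.
Unshelve. all: by end_near. Qed.

Lemma is_derive_expR_comp f z v (df : R) : differentiable f z ->
  is_derive z v f df -> is_derive z v (expR \o f) (expR (f z) * df).
Proof.
move=> Df [_ <-].
have De := differentiable_expR (f z).
apply: DeriveDef; first exact/diff_derivable/differentiable_comp.
rewrite deriveE; last exact: differentiable_comp.
rewrite diff_comp//= deriveE// deriv1E; last exact: derivable_expR.
by rewrite derive1E [X in _ *: X](@derive_val _ _ _ _ _ _ (expR (f z))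
  (is_derive_expR (f z))) mulrC.
Qed.

Lemma exppoly_derive f v : exppoly f -> exppoly ('D_v f).
Proof.
elim=> {f} [c|i||f g ef e'f eg e'g|f g ef e'f eg e'g|f ef e'f].
- rewrite (_ : 'D_v _ = cst 0); first exact: exppoly_cst.
  by apply/funext => z; exact: derive_cst.
- rewrite (_ : 'D_v _ = cst (v.1 ord0 i)); first exact: exppoly_cst.
  by apply/funext => z; rewrite derive_val.
- rewrite (_ : 'D_v _ = cst v.2); first exact: exppoly_cst.
  by apply/funext => z; rewrite derive_val.
- rewrite (_ : 'D_v _ = 'D_v f + 'D_v g); first exact: exppolyD.
  apply/funext => z; rewrite deriveD//;
    exact/diff_derivable/exppoly_differentiable.
- rewrite (_ : 'D_v _ = f * 'D_v g + g * 'D_v f).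
    by apply: exppolyD; exact: exppolyM.
  apply/funext => z; rewrite deriveM//;
    exact/diff_derivable/exppoly_differentiable.
- rewrite (_ : 'D_v _ = (expR \o f) * 'D_v f).
    by apply: exppolyM => //; exact: exppoly_exp.
  apply/funext => z.
  have Df := exppoly_differentiable f z ef.
  have fD : is_derive z v f ('D_v f z).
    by apply: DeriveDef => //; exact: diff_derivable.
  by have [_] := is_derive_expR_comp f z v ('D_v f z) Df fD.
Qed.

Lemma exppoly_smooth f : exppoly f -> smooth f.
Proof.
move=> ef s _ /=.
have es : exppoly (foldr (fun v g => 'D_v g) f s).
  by elim: s => //= v s IH; exact: exppoly_derive.
split=> [z|v _ z]; first exact/differentiable_continuous/exppoly_differentiable.
exact/diff_derivable/exppoly_differentiable.
Qed.

Lemma exppoly_sum n (h : 'I_n -> V -> R) :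
  (forall i, exppoly (h i)) -> exppoly (\sum_(i < n) h i).
Proof.
move=> eh; apply: (big_ind exppoly) => //; first exact: exppoly_cst.
by move=> f g; exact: exppolyD.
Qed.

End exppoly.

#[local] Existing Instance is_derive_xcoord.
#[local] Existing Instance is_derive_tcoord.

(** * Comparison with smooth barriers *)

Section comparison.
Context {R : realType} {d : nat}.
Local Notation V := ('rV[R]_d * R)%type.
Implicit Types (f g psi phi w : V -> R) (z v : V).

(** The square of the Euclidean norm. *)
Definition sqnorm (x : 'rV[R]_d) : R := \sum_(i < d) x ord0 i ^+ 2.

Lemma sqnorm_ge0 (x : 'rV[R]_d) : 0 <= sqnorm x.
Proof. by apply: sumr_ge0 => i _; exact: sqr_ge0. Qed.

Lemma sqr_coord_le_sqnorm (x : 'rV[R]_d) i : x ord0 i ^+ 2 <= sqnorm x.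
Proof.
rewrite /sqnorm (bigD1 i)//= lerDl; apply: sumr_ge0 => j _; exact: sqr_ge0.
Qed.

(** A continuous function on the closed half-space that tends to minus infinity
    at infinity attains its maximum. *)
Lemma halfspace_max g (B e : R) : 0 < e ->
  {within halfspace, continuous g} ->
  (forall z, halfspace z -> g z <= B - e * (z.2 + sqnorm z.1)) ->
  exists2 zm, halfspace zm & forall z, halfspace z -> g z <= g zm.
Proof.
move=> e0 cg gB.
(* Outside the compact set K below, g is at most B - e * r <= g 0. *)
pose r := 1 + `|B - g 0| / e.
have r1 : 1 <= r by rewrite /r lerDl divr_ge0// ltW.
have r0 : 0 <= r by apply: le_trans r1.
pose K : set V := [set x : 'rV[R]_d | forall i, `[- r, r]%classic (x ord0 i)]
  `*` `[0, r]%classic.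
have cK : compact K.
  apply: compact_setX; last exact: segment_compact.
  have := @rV_compact R d (fun=> `[- r, r]%classic); apply => i.
  exact: segment_compact.
have KH : K `<=` halfspace.
  by move=> z [_ /=]; rewrite in_itv/= => /andP[].
have K0 : K 0.
  split => [i|] /=; first by rewrite !mxE in_itv/= oppr_le0 r0.
  by rewrite in_itv/= lexx.
have [||zm /set_mem Kzm zmM] := compact_EVT_max (A := K) (f := g) _ cK.
- by exists 0.
- exact: continuous_subspaceW cg.
exists zm => [|z Hz]; first exact: KH.
have [Kz|nKz] := pselect (K z); first by apply: zmM; exact: mem_set.
apply: le_trans (zmM 0 (mem_set K0)).
have rz : r <= z.2 + sqnorm z.1.
  have s0 := sqnorm_ge0 z.1; have t0 : 0 <= z.2 by exact: Hz.
  have [tr|rt] := leP z.2 r; last by lra.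
  have [i ni] : exists i, ~ `[- r, r]%classic (z.1 ord0 i).
    apply: contrapT => /forallNP H; apply: nKz; split=> [i|/=].
      by apply: contrapT; exact: H.
    by rewrite in_itv/= t0.
  move/negP: ni; rewrite /= in_itv/= -ler_norml -ltNge => ri.
  have := sqr_coord_le_sqnorm z.1 i; rewrite -real_normK ?num_real//.
  by nra.
apply: le_trans (gB z Hz) _.
have : e * r <= e * (z.2 + sqnorm z.1) by rewrite ler_pM2l.
rewrite /r mulrDr mulr1 mulrCA divff ?gt_eqF// mulr1.
by have := ler_norm (B - g 0); lra.
Qed.

(** The function exp ((d + 1) t) (1 + |x|^2): a strict supersolution of the
    equation that tends to infinity at infinity of the closed half-space. *)
Definition penalty : V -> R :=
  (expR \o (cst d.+1%:R * tcoord)) * (cst 1 + \sum_(i < d) xcoord i * xcoord i).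

Lemma exppoly_penalty : exppoly penalty.
Proof.
apply: exppolyM.
  by apply/exppoly_exp/exppolyM; [exact: exppoly_cst|exact: exppoly_t].
apply: exppolyD; first exact: exppoly_cst.
by apply: exppoly_sum => i; apply: exppolyM; exact: exppoly_x.
Qed.

Lemma penaltyE z : penalty z = expR (d.+1%:R * z.2) * (1 + sqnorm z.1).
Proof.
rewrite /penalty /= [LHS]/(expR _ * (1 + _)).
by congr (_ * (1 + _)); rewrite fct_sumE.
Qed.

Lemma penalty_gt0 z : 0 < penalty z.
Proof.
rewrite penaltyE mulr_gt0 ?expR_gt0//.
by rewrite ltr_pwDl// sqnorm_ge0.
Qed.

Lemma penalty_ge z : halfspace z -> z.2 + sqnorm z.1 <= penalty z.
Proof.
rewrite /halfspace /= => t0; rewrite penaltyE.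
have s0 := sqnorm_ge0 z.1.
have : 1 + z.2 <= expR (d.+1%:R * z.2).
  apply: le_trans (expR_ge1Dx _); rewrite lerD2l ler_peMl//.
  by rewrite ler1n.
by nra.
Qed.

Lemma is_derive_penalty z v : is_derive z v penalty
  (expR (d.+1%:R * z.2) *
   (d.+1%:R * v.2 * (1 + sqnorm z.1) + \sum_(i < d) 2 * z.1 ord0 i * v.1 ord0 i)).
Proof.
have dE : is_derive z v (expR \o (cst d.+1%:R * tcoord))
    (expR (d.+1%:R * z.2) * (d.+1%:R * v.2)).
  apply: is_derive_expR_comp.
    apply/exppoly_differentiable/exppolyM; first exact: exppoly_cst.
    exact: exppoly_t.
  by apply: is_derive_eq; rewrite scaler0 addr0.
apply: is_derive_eq.
have -> : (expR \o (cst d.+1%:R * tcoord)) z = expR (d.+1%:R * z.2) by [].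
rewrite add0r /GRing.scale /=.
have -> : (cst 1 + \sum_(i < d) xcoord i * xcoord i) z = 1 + sqnorm z.1 :> R.
  by rewrite [LHS]/(1 + _) fct_sumE.
rewrite (eq_bigr (fun i => 2 * z.1 ord0 i * v.1 ord0 i)).
  by ring.
by move=> i _; rewrite /xcoord; ring.
Qed.

Lemma derive_t_penalty z : 'D_dt penalty z = d.+1%:R * penalty z.
Proof.
have [_ ->] := is_derive_penalty z dt; rewrite penaltyE /= mulr1.
rewrite big1 ?addr0; first by rewrite mulrCA.
by move=> i _; rewrite mxE mulr0.
Qed.

(** With [derive_t_penalty], this says that the penalty is a strict
    supersolution; the rate d + 1 comes from 2 |x_i| <= 1 + x_i^2. *)
Lemma sum_derive_x_penalty_lt z :
  \sum_(i < d) `|'D_(dx i) penalty z| < d.+1%:R * penalty z.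
Proof.
have E0 := expR_gt0 (d.+1%:R * z.2).
rewrite [ltRHS](_ : _ =
    expR (d.+1%:R * z.2) * (d.+1%:R * (1 + sqnorm z.1))); last first.
  by rewrite penaltyE mulrCA.
rewrite [ltLHS](_ : _ =
    expR (d.+1%:R * z.2) * \sum_(i < d) (2 * `|z.1 ord0 i|)).
  rewrite ltr_pM2l//; have s0 := sqnorm_ge0 z.1.
  apply: (@le_lt_trans _ _ (\sum_(i < d) (1 + z.1 ord0 i ^+ 2))).
    apply: ler_sum => i _; rewrite -real_normK ?num_real//.
    by have := sqr_ge0 (`|z.1 ord0 i| - 1); nra.
  rewrite big_split /= sumr_const card_ord -/(sqnorm _) -[d.+1%:R]natr1.
  have : 0 <= d%:R * sqnorm z.1 :> R by rewrite mulr_ge0.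
  by rewrite mulrDr mulr1 mulrDl mul1r; lra.
rewrite mulr_sumr; apply: eq_bigr => i _.
have [_ ->] := is_derive_penalty z (dx i).
rewrite /= mulr0 mul0r add0r normrM gtr0_norm//; congr (_ * _).
rewrite (bigD1 i)//= big1 ?addr0; last first.
  by move=> j ji; rewrite mxE eqxx/= (negbTE ji) mulr0.
by rewrite mxE !eqxx mulr1 normrM ger0_norm.
Qed.

Lemma le_barrier_penalty (a b : R) z :
  (forall e : R, 0 < e -> a <= b + e * penalty z) -> a <= b.
Proof.
move=> H; apply/ler_addgt0Pr => e e0.
have p0 := penalty_gt0 z.
by have := H (e / penalty z) (divr_gt0 e0 p0); rewrite divfK ?gt_eqF.
Qed.

Lemma derive_penalized w (e : R) z v : exppoly w ->
  'D_v (w + cst e * penalty) z = 'D_v w z + e * 'D_v penalty z.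
Proof.
move=> ew; have Dw : derivable w z v.
  exact/diff_derivable/exppoly_differentiable.
have Dp : derivable penalty z v.
  exact/diff_derivable/exppoly_differentiable/exppoly_penalty.
rewrite deriveD//; last by apply: derivableM => //; exact: derivable_cst.
by congr (_ + _); rewrite deriveMl.
Qed.

Lemma exppoly_penalized w (e : R) : exppoly w -> exppoly (w + cst e * penalty).
Proof.
move=> ew; apply: exppolyD => //; apply: exppolyM; first exact: exppoly_cst.
exact: exppoly_penalty.
Qed.

Lemma Cb_halfspace_bound phi : Cb halfspace phi ->
  exists M : R, forall z, halfspace z -> `|phi z| <= M.
Proof.
move=> [_ [M [Mr HM]]]; exists (M + 1) => z Hz.
by apply: HM => //; rewrite ltrDl.
Qed.

Lemma within_continuousB phi w : Cb halfspace phi -> exppoly w ->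
  {within halfspace, continuous (phi \- w)}.
Proof.
move=> [cphi _] ew z; apply: cvgB; first exact: cphi.
apply: continuous_subspaceT => {}z.
exact/differentiable_continuous/exppoly_differentiable.
Qed.

(** Comparison with a smooth supersolution bounded below. *)
Lemma viscosity_le_supersolution (phi0 : 'rV[R]_d -> R) phi w (m : R) :
  viscosity_solution phi0 phi -> exppoly w ->
  (forall z, halfspace z -> m <= w z) ->
  (forall z, \sum_(i < d) `|'D_(dx i) w z| <= 'D_dt w z) ->
  (forall x, phi0 x <= w (x, 0)) ->
  forall z, halfspace z -> phi z <= w z.
Proof.
move=> [Cphi phi_0 visc] ew wm wsup phi0w z0 Hz0.
apply: (le_barrier_penalty _ _ z0) => e e0; rewrite leNgt; apply/negP => ltz0.
have [M phiM] := Cb_halfspace_bound phi Cphi.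
pose psi : V -> R := w + cst e * penalty.
have psiE z : psi z = w z + e * penalty z by [].
have epsi : exppoly psi by exact: exppoly_penalized.
have [|zm Hzm zmax] := halfspace_max (phi \- psi) (M - m) e e0
    (within_continuousB phi psi Cphi epsi).
  move=> z Hz; have := phiM z Hz; rewrite ler_norml => /andP[_ ?].
  have : e * (z.2 + sqnorm z.1) <= e * penalty z.
    by rewrite ler_pM2l// penalty_ge.
  by have := wm z Hz; rewrite /= psiE; lra.
have gm : 0 < phi zm - psi zm.
  apply: lt_le_trans (zmax z0 Hz0).
  by rewrite /= psiE subr_gt0.
(* The maximum point has positive time, as phi <= psi initially. *)
have tm : 0 < zm.2.
  rewrite lt_neqAle [_ <= _]Hzm andbT; apply/eqP => tm.
  move: gm; rewrite (surjective_pairing zm) -tm phi_0.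
  have : 0 < e * penalty (zm.1, 0) by rewrite mulr_gt0// penalty_gt0.
  by have := phi0w zm.1; rewrite psiE; lra.
have [+ _] := visc psi (exppoly_smooth psi epsi) zm.1 zm.2 tm.
have lm : local_max_at halfspace (phi \- psi) zm.
  by apply: (filterE (F := nbhs zm)) => z; exact: zmax.
rewrite -surjective_pairing => /(_ lm).
apply/negP; rewrite -ltNge derive_penalized// derive_t_penalty.
apply: (@le_lt_trans _ _ (\sum_(i < d) (`|'D_(dx i) w zm| +
    e * `|'D_(dx i) penalty zm|))).
  apply: ler_sum => i _; rewrite derive_penalized//.
  by apply: le_trans (ler_normD _ _) _; rewrite normrM (gtr0_norm e0).
rewrite big_split /= -mulr_sumr ler_ltD// ltr_pM2l//.
exact: sum_derive_x_penalty_lt.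
Qed.

(** Comparison with a smooth subsolution bounded above. *)
Lemma viscosity_ge_subsolution (phi0 : 'rV[R]_d -> R) phi w (m : R) :
  viscosity_solution phi0 phi -> exppoly w ->
  (forall z, halfspace z -> w z <= m) ->
  (forall z, 'D_dt w z <= \sum_(i < d) `|'D_(dx i) w z|) ->
  (forall x, w (x, 0) <= phi0 x) ->
  forall z, halfspace z -> w z <= phi z.
Proof.
move=> [Cphi phi_0 visc] ew wm wsub phi0w z0 Hz0.
apply: (le_barrier_penalty _ _ z0) => e e0; rewrite leNgt; apply/negP => ltz0.
have [M phiM] := Cb_halfspace_bound phi Cphi.
pose psi : V -> R := w + cst (- e) * penalty.
have psiE z : psi z = w z + - e * penalty z by [].
have epsi : exppoly psi by exact: exppoly_penalized.
have gE z : (- (phi \- psi) : V -> R) z = psi z - phi z by exact: opprB.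
have cg : {within halfspace, continuous (- (phi \- psi))}.
  by move=> z; apply: cvgN; exact: within_continuousB.
have [|zm Hzm zmax] := halfspace_max (- (phi \- psi)) (M + m) e e0 cg.
  move=> z Hz; have := phiM z Hz; rewrite ler_norml => /andP[? _].
  have : e * (z.2 + sqnorm z.1) <= e * penalty z.
    by rewrite ler_pM2l// penalty_ge.
  by have := wm z Hz; rewrite gE psiE; lra.
have gm : 0 < psi zm - phi zm.
  rewrite -gE; apply: lt_le_trans (zmax z0 Hz0).
  by rewrite gE psiE; lra.
have tm : 0 < zm.2.
  rewrite lt_neqAle [_ <= _]Hzm andbT; apply/eqP => tm.
  move: gm; rewrite (surjective_pairing zm) -tm phi_0.
  have : 0 < e * penalty (zm.1, 0) by rewrite mulr_gt0// penalty_gt0.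
  by have := phi0w zm.1; rewrite psiE; lra.
have [_ +] := visc psi (exppoly_smooth psi epsi) zm.1 zm.2 tm.
have lm : local_min_at halfspace (phi \- psi) zm.
  by apply: (filterE (F := nbhs zm)) => z Hz; rewrite -lerN2; exact: zmax.
rewrite -surjective_pairing => /(_ lm).
apply/negP; rewrite -ltNge derive_penalized// derive_t_penalty.
have : \sum_(i < d) `|'D_(dx i) w zm| <=
    \sum_(i < d) (`|'D_(dx i) psi zm| + e * `|'D_(dx i) penalty zm|).
  apply: ler_sum => i _; rewrite derive_penalized//.
  rewrite -[X in `|X| <= _](subrK (e * 'D_(dx i) penalty zm)) -mulNr.
  by apply: le_trans (ler_normD _ _) _; rewrite normrM (gtr0_norm e0).
rewrite big_split /= -mulr_sumr.
have := sum_derive_x_penalty_lt zm; rewrite -(ltr_pM2l e0).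
have := wsub zm; lra.
Qed.

End comparison.

(** * Explicit barriers and bounds on the solutions *)

Section barriers.
Context {R : realType} {d : nat}.
Local Notation V := ('rV[R]_d * R)%type.
Implicit Types (z v : V) (x : 'rV[R]_d).

Lemma enorm_ge0 x : 0 <= enorm x.
Proof. exact: sqrtr_ge0. Qed.

Lemma sqr_enorm x : enorm x ^+ 2 = sqnorm x.
Proof. by rewrite sqr_sqrtr// sqnorm_ge0. Qed.

Lemma coord_le_enorm x i : `|x ord0 i| <= enorm x.
Proof. by rewrite -sqrtr_sqr ler_wsqrtr// sqr_coord_le_sqnorm. Qed.

Lemma hat_ge0 n x : 0 <= hat n x.
Proof. by rewrite /hat le_max lexx orbT. Qed.

Lemma hat_le1 n x : hat n x <= 1.
Proof. by rewrite /hat ge_max ler01 andbT gerBl mulr_ge0// enorm_ge0. Qed.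

Lemma hat_eq0 n x i : (0 < n)%N -> n%:R^-1 <= `|x ord0 i| -> hat n x = 0.
Proof.
move=> n0 nx; apply/max_idPr; rewrite subr_le0.
have n0' : 0 < n%:R :> R by rewrite ltr0n.
have := le_trans nx (coord_le_enorm x i).
by rewrite -(ler_pM2l n0') mulfV ?gt_eqF.
Qed.

(** The plane wave exp (k (t + s x_i + c)); it solves the equation when
    0 <= k and |s| = 1. *)
Definition planewave (k s c : R) (i : 'I_d) : V -> R :=
  expR \o (cst k * (tcoord + cst s * xcoord i + cst c)).

Lemma exppoly_planewave k s c i : exppoly (planewave k s c i).
Proof.
apply/exppoly_exp/exppolyM; first exact: exppoly_cst.
apply: exppolyD; last exact: exppoly_cst.
apply: exppolyD; first exact: exppoly_t.
by apply: exppolyM; [exact: exppoly_cst|exact: exppoly_x].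
Qed.

Lemma derive_planewave k s c i z v : 'D_v (planewave k s c i) z =
  planewave k s c i z * (k * (v.2 + s * v.1 ord0 i)).
Proof.
have lin : exppoly (cst k * (tcoord + cst s * xcoord i + cst c) : V -> R).
  apply: exppolyM; first exact: exppoly_cst.
  apply: exppolyD; last exact: exppoly_cst.
  apply: exppolyD; first exact: exppoly_t.
  by apply: exppolyM; [exact: exppoly_cst|exact: exppoly_x].
have dlin : is_derive z v (cst k * (tcoord + cst s * xcoord i + cst c) : V -> R)
    (k * (v.2 + s * v.1 ord0 i)).
  by apply: is_derive_eq; rewrite !scaler0 !addr0.
have [_] := is_derive_expR_comp _ z v _ (exppoly_differentiable _ z lin) dlin.
exact.
Qed.

(** The paraboloid a - K |x|^2 travelling with velocity u, that is
    a - K |x - t u|^2; it is a subsolution when the coordinates of u lie in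
    [-1, 1]. *)
Definition travelling (a K : R) (u : 'rV[R]_d) : V -> R :=
  cst a + cst (- K) * \sum_(i < d)
    (xcoord i + cst (- u ord0 i) * tcoord) * (xcoord i + cst (- u ord0 i) * tcoord).

Lemma exppoly_travelling a K u : exppoly (travelling a K u).
Proof.
apply: exppolyD; first exact: exppoly_cst.
apply: exppolyM; first exact: exppoly_cst.
have lin i : exppoly (xcoord i + cst (- u ord0 i) * tcoord : V -> R).
  apply: exppolyD; first exact: exppoly_x.
  by apply: exppolyM; [exact: exppoly_cst|exact: exppoly_t].
by apply: exppoly_sum => i; exact: exppolyM.
Qed.

Lemma travellingE a K u z :
  travelling a K u z = a - K * sqnorm (z.1 - z.2 *: u).
Proof.
rewrite [LHS]/(a + - K * _) fct_sumE mulNr; congr (_ - _ * _).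
apply: eq_bigr => i _; rewrite !mxE.
have xE : (xcoord i + cst (- u ord0 i) * tcoord : V -> R) z =
  z.1 ord0 i + - u ord0 i * z.2 by [].
by rewrite expr2 [LHS](congr2 *%R xE xE); ring.
Qed.

Lemma derive_travelling a K u z v : 'D_v (travelling a K u) z =
  - K * \sum_(i < d) 2 * (z.1 - z.2 *: u) ord0 i * (v.1 - v.2 *: u) ord0 i.
Proof.
apply: derive_val; apply: is_derive_eq.
rewrite !scaler0 addr0 add0r /GRing.scale /=; congr (_ * _).
apply: eq_bigr => i _; rewrite !mxE addr0.
have -> : (xcoord i + cst (- u ord0 i) * tcoord : V -> R) z =
  z.1 ord0 i + - u ord0 i * z.2 by [].
by ring.
Qed.

Lemma derive_x_travelling a K u z i : 'D_(dx i) (travelling a K u) z =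
  - K * (2 * (z.1 - z.2 *: u) ord0 i).
Proof.
have delta j : (dx i : V).1 ord0 j = (i == j)%:R by rewrite mxE eqxx eq_sym.
rewrite derive_travelling scale0r subr0; congr (_ * _).
rewrite (bigD1 i)//= big1 ?addr0.
  by rewrite [delta_mx _ _ _ _]delta eqxx mulr1.
by move=> j ji; rewrite [delta_mx _ _ _ _]delta eq_sym (negbTE ji) mulr0.
Qed.

Lemma derive_t_travelling a K u z : 'D_dt (travelling a K u) z =
  \sum_(i < d) (- K * (2 * (z.1 - z.2 *: u) ord0 i)) * - u ord0 i.
Proof.
rewrite derive_travelling mulr_sumr; apply: eq_bigr => i _.
by rewrite scale1r sub0r [in RHS]mulrA [(- u) _ _]mxE !mulrA.
Qed.

Section hat_solution.
Context (n : nat) (phi : V -> R) (phi_sol : viscosity_solution (hat n) phi).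

Lemma sol_le1 z : halfspace z -> phi z <= 1.
Proof.
apply: (viscosity_le_supersolution (hat n) phi (cst 1) 1 phi_sol) => //.
- exact: exppoly_cst.
- move=> {}z; rewrite big1 ?derive_cst// => i _.
  by rewrite derive_cst normr0.
- by move=> x; exact: hat_le1.
Qed.

Lemma sol_ge0 z : halfspace z -> 0 <= phi z.
Proof.
apply: (viscosity_ge_subsolution (hat n) phi (cst 0) 0 phi_sol) => //.
- exact: exppoly_cst.
- by move=> {}z; rewrite derive_cst sumr_ge0.
- by move=> x; exact: hat_ge0.
Qed.

Lemma sol_le_planewave k s i x t : (0 < n)%N -> 0 <= k -> `|s| = 1 -> 0 <= t ->
  phi (x, t) <= planewave k s n%:R^-1 i (x, t).
Proof.
move=> n0 k0 s1 t0.
apply: (viscosity_le_supersolution (hat n) phi _ 0 phi_sol) => //.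
- exact: exppoly_planewave.
- by move=> z _; exact: expR_ge0.
- move=> z; rewrite derive_planewave /= mxE mulr0 addr0 mulr1.
  rewrite (bigD1 i)//= big1 ?addr0; last first.
    move=> j ji; rewrite derive_planewave /= mxE eqxx/= eq_sym (negbTE ji).
    by rewrite mulr0 addr0 !mulr0 normr0.
  rewrite derive_planewave /= mxE !eqxx add0r mulr1 !normrM s1 mulr1.
  by rewrite (ger0_norm k0) ger0_norm// expR_ge0.
- move=> y; have pE : planewave k s n%:R^-1 i (y, 0) =
    expR (k * (0 + s * y ord0 i + n%:R^-1)) by [].
  rewrite pE add0r; have [ny|yn] := leP n%:R^-1 `|y ord0 i|.
    by rewrite (hat_eq0 n y i n0)// expR_ge0.
  apply: le_trans (hat_le1 n y) _; rewrite -[leLHS]expR0 ler_expR.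
  rewrite mulr_ge0//; have := ler_norm (- (s * y ord0 i)).
  by rewrite normrN normrM s1 mul1r; lra.
Qed.

(** Finite speed of propagation. *)
Lemma sol_eq0 i x t : (0 < n)%N -> 0 <= t ->
  t + n%:R^-1 < `|x ord0 i| -> phi (x, t) = 0.
Proof.
move=> n0 t0 tx; apply/eqP; rewrite eq_le sol_ge0// andbT.
apply/ler_addgt0Pr => e e0; rewrite add0r.
have [s [s1 sx]] : exists s : R, `|s| = 1 /\ s * x ord0 i = - `|x ord0 i|.
  have [x0|x0] := leP 0 (x ord0 i).
    by exists (-1); rewrite normrN1 mulN1r ger0_norm.
  by exists 1; rewrite normr1 mul1r ltr0_norm// opprK.
pose a := `|x ord0 i| - t - n%:R^-1.
have a0 : 0 < a by rewrite /a; lra.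
(* With k = 1 / (e a) the barrier is exp (- 1 / e) <= e at (x, t). *)
have k0 : 0 <= e^-1 / a by rewrite divr_ge0 ?invr_ge0// ltW.
apply: le_trans (sol_le_planewave (e^-1 / a) s i x t n0 k0 s1 t0) _.
have -> : planewave (e^-1 / a) s n%:R^-1 i (x, t) =
  expR (e^-1 / a * (t + s * x ord0 i + n%:R^-1)) by [].
rewrite sx (_ : t + _ + _ = - a); last by rewrite /a; ring.
rewrite mulrN divfK ?gt_eqF// expRN -[leRHS]invrK.
rewrite lef_pV2 ?posrE ?expR_gt0 ?invr_gt0//.
by apply: le_trans (expR_ge1Dx _); rewrite lerDr.
Qed.

(** A paraboloid below the cone: n r <= e + n^2 / (4 e) r^2 for all r. *)
Lemma travelling_le_hat (e : R) x : 0 < e ->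
  1 - e - n%:R ^+ 2 / (4 * e) * sqnorm x <= hat n x.
Proof.
move=> e0; rewrite /hat le_max -sqr_enorm -addrA lerD2l -opprD lerN2.
apply/orP; left.
have : 0 <= (2 * e - n%:R * enorm x) ^+ 2 / (4 * e).
  by rewrite divr_ge0 ?sqr_ge0// mulr_ge0// ltW.
have -> : (2 * e - n%:R * enorm x) ^+ 2 / (4 * e) =
  (e + n%:R ^+ 2 / (4 * e) * enorm x ^+ 2) - n%:R * enorm x.
  by field; rewrite gt_eqF.
by rewrite subr_ge0.
Qed.

(** The initial peak value 1 reaches x by time t, at velocity x / t. *)
Lemma sol_eq1 x t : 0 < t -> (forall i, `|x ord0 i| <= t) -> phi (x, t) = 1.
Proof.
move=> t0 xt; have Hz : halfspace (x, t) by exact: ltW.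
apply/eqP; rewrite eq_le sol_le1//=.
apply/ler_addgt0Pr => e e0; rewrite -lerBlDr.
pose K := n%:R ^+ 2 / (4 * e); pose u := t^-1 *: x.
have K0 : 0 <= K by rewrite divr_ge0 ?sqr_ge0// mulr_ge0// ltW.
have -> : 1 - e = travelling (1 - e) K u (x, t).
  rewrite travellingE /= scalerA mulfV ?gt_eqF// scale1r subrr.
  rewrite /sqnorm big1 ?mulr0 ?subr0// => i _.
  by rewrite mxE expr0n.
apply: (viscosity_ge_subsolution (hat n) phi _ (1 - e) phi_sol) => //.
- exact: exppoly_travelling.
- by move=> z _; rewrite travellingE gerBl mulr_ge0// sqnorm_ge0.
- move=> z; rewrite derive_t_travelling; apply: ler_sum => i _.
  rewrite derive_x_travelling; apply: le_trans (ler_norm _) _.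
  rewrite normrM -[leRHS]mulr1 ler_wpM2l// normrN mxE normrM normfV.
  by rewrite (gtr0_norm t0) mulrC ler_pdivrMr// mul1r.
- by move=> y; rewrite travellingE /= scale0r subr0; exact: travelling_le_hat.
Qed.

End hat_solution.

End barriers.

(** * Measurability and measure of sets in R^d *)

Section measure_rV.
Context {R : realType} {d : nat}.
Local Notation leb := (@lebesgue_rV R d).
Implicit Types (x y : 'rV[R]_d).

Lemma measurable_box (A : 'I_d -> set (measurableTypeR R)) :
  (forall i, measurable (A i)) ->
  measurable [set x : 'rV[R]_d | forall i, A i (x ord0 i)].
Proof.
move=> mA; rewrite (_ : [set _ | _] = \bigcap_(i in setT)
    ((fun x : 'rV[R]_d => x ord0 i : measurableTypeR R) @^-1` A i)).
  apply: fin_bigcap_measurable => // i _.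
  by rewrite -[X in measurable X]setTI; exact: measurable_coord.
by apply/seteqP; split=> x /= Ax i => [_|]; exact: Ax.
Qed.

(** The cell of mesh 1 / (k + 1) with lower corner c / (k + 1). *)
Definition grid_cell (k : nat) (c : 'rV[int]_d) : set 'rV[R]_d :=
  [set x | forall i, Num.floor (k.+1%:R * x ord0 i) = c ord0 i].

Lemma measurable_grid_cell k c : measurable (grid_cell k c).
Proof.
have -> : grid_cell k c = [set x | forall i,
    `[(c ord0 i)%:~R / k.+1%:R, (c ord0 i + 1)%:~R / k.+1%:R[%classic (x ord0 i)].
  have k0 : 0 < k.+1%:R :> R by rewrite ltr0n.
  apply/seteqP; split=> x /= xc i; have := xc i.
    move=> <-; rewrite in_itv/= ler_pdivrMr// ltr_pdivlMr// mulrC.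
    exact: floor_itv.
  rewrite in_itv/= ler_pdivrMr// ltr_pdivlMr// mulrC => h.
  exact: floor_def.
by apply: (measurable_box (fun i =>
    `[(c ord0 i)%:~R / k.+1%:R, (c ord0 i + 1)%:~R / k.+1%:R[%classic)).
Qed.

Lemma grid_cell_ball k c x y : grid_cell k c x -> grid_cell k c y ->
  ball x (k.+1%:R^-1) y.
Proof.
move=> cx cy; have k0 : 0 < k.+1%:R :> R by rewrite ltr0n.
split=> [|i j]; first by rewrite invr_gt0.
rewrite (ord1 i) /ball /=.
have := cx j; have := cy j => <- /(congr1 (fun z : int => z%:~R : R)).
have := floor_itv (k.+1%:R * x ord0 j); have := floor_itv (k.+1%:R * y ord0 j).
rewrite !intrD => /andP[? ?] /andP[? ?] ?.
rewrite -(ltr_pM2l k0) mulfV ?gt_eqF// -[X in X * _](gtr0_norm k0) -normrM.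
by rewrite ltr_norml mulrBr; apply/andP; split; lra.
Qed.

(** Every open set is the countable union of the grid cells that it contains,
    so the sigma-algebra generated by the coordinates contains the Borel sets. *)
Lemma measurable_open_rV (U : set 'rV[R]_d) : open U -> measurable U.
Proof.
move=> oU.
(* Pairs of a mesh and a cell are enumerated by their codes in nat. *)
pose F j := if unpickle j is Some (k, c) then
  (if `[< grid_cell k c `<=` U >] then grid_cell k c else set0) else set0.
rewrite (_ : U = \bigcup_j F j).
  apply: bigcupT_measurable => j; rewrite /F; case: unpickle => [[k c]|//].
  by case: ifPn => // _; exact: measurable_grid_cell.
apply/seteqP; split=> [x Ux|x [j _]]; last first.
  by rewrite /F; case: unpickle => [[k c]|//]; case: ifPn => // /asboolP; exact.
have /nbhs_ballP[e /= e0 xeU] : nbhs x U by exact: open_nbhs_nbhs.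
have [k ke] : exists k : nat, k.+1%:R^-1 < e.
  exists (Num.truncn e^-1); rewrite -[ltRHS]invrK ltf_pV2 ?posrE ?invr_gt0 ?ltr0n//.
  exact: truncnS_gt.
pose c : 'rV[int]_d := \row_i Num.floor (k.+1%:R * x ord0 i).
have cx : grid_cell k c x by move=> i; rewrite mxE.
exists (pickle (k, c)) => //; rewrite /F pickleK.
case: ifPn => // /asboolP[] y cy; apply: xeU.
exact: (le_ball (ltW ke) (grid_cell_ball k c x y cx cy)).
Qed.

Lemma measurable_continuous_rV (f : 'rV[R]_d -> R) :
  continuous f -> measurable_fun setT f.
Proof.
move=> cf; apply: (measurability _ (RGenOpens.measurableE R)).
move=> _ [_ [a [b ->]] <-]; rewrite setTI; apply: measurable_open_rV.
by apply: open_comp; [move=> x _; exact: cf|exact: interval_open].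
Qed.

Lemma cube0E (r : R) : cube r 0 =
  [set x : 'rV[R]_d | forall i, `[- r, r]%classic (x ord0 i)].
Proof.
by apply/seteqP; split=> x /= h i; have := h i;
  rewrite /= in_itv/= mxE subr0 ler_norml.
Qed.

Lemma measurable_cube0 (r : R) : measurable (cube r 0 : set 'rV[R]_d).
Proof. by rewrite cube0E; apply: (measurable_box (fun=> `[- r, r]%classic)). Qed.

Lemma lebesgue_cube0 (r : R) : 0 <= r -> leb (cube r 0) = ((2 * r) ^+ d)%:E.
Proof.
move=> r0; rewrite cube0E.
rewrite (@lebesgue_rV_box R d (fun=> `[- r, r]%classic))//.
rewrite (eq_bigr (fun=> (2 * r)%:E)).
  by rewrite big_const_ord; elim: d => //= n ->; rewrite exprS EFinM.
move=> i _; rewrite lebesgue_measure_itv/= lte_fin.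
case: ltP => [_|rr]; first by rewrite -EFinB opprK; congr (_%:E); ring.
by congr (_%:E); lra.
Qed.

End measure_rV.

(** * Integrals and convergence in L^1 *)

Section integral.
Local Open Scope ereal_scope.
Context d0 (T : measurableType d0) (R : realType).
Variable mu : {measure set T -> \bar R}.

(** Monotonicity of the integral with no measurability assumption, needed for
    the function x |-> ess sup of |f| over x + [-1, 1]^d: the positive part of f
    lies below g, and the integral of a nonnegative function is a supremum over
    the simple functions below it. *)
Lemma integral_le_ge0 (f g : T -> \bar R) : (forall x, 0 <= g x) ->
  (forall x, f x <= g x) -> \int[mu]_x f x <= \int[mu]_x g x.
Proof.
move=> g0 fg; rewrite integralE.
apply: (@le_trans _ _ (\int[mu]_x f^\+ x)).
  by rewrite -[leRHS]adde0 leeD2l// oppe_le0 integral_ge0.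
rewrite !ge0_integralTE//; apply: le_ereal_sup => _ [h /= hf <-].
exists h => // x; apply: le_trans (hf x) _.
by rewrite funeposE ge_max fg g0.
Qed.

End integral.

Section L1.
Context {R : realType} {d : nat}.
Local Notation leb := (@lebesgue_rV R d).

Lemma integral_indic_rV (A : set 'rV[R]_d) : measurable A ->
  (\int[leb]_x (\1_A x)%:E = leb A)%E.
Proof. by move=> mA; rewrite integral_indic// setIT. Qed.

Lemma integrable_indic_rV (A : set 'rV[R]_d) : measurable A ->
  (leb A < +oo)%E -> leb.-integrable setT (EFin \o \1_A).
Proof.
move=> mA Aoo; apply/integrableP; split.
  by apply/measurable_EFinP; exact: measurable_indic.
rewrite (eq_integral (EFin \o \1_A)) ?integral_indic_rV// => x _ /=.
by rewrite ger0_norm.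
Qed.

(** Convergence in L^1 from a bound by indicators of sets of vanishing measure. *)
Lemma L1_cvg_indic_bound (f : nat -> 'rV[R]_d -> R) (g : 'rV[R]_d -> R)
    (A : nat -> set 'rV[R]_d) (a : nat -> R) :
  (forall n, measurable_fun setT (f n)) ->
  leb.-integrable setT (EFin \o g) ->
  (forall n, measurable (A n)) -> (forall n, leb (A n) = (a n)%:E) ->
  a @ \oo --> 0 ->
  (forall n x, `|f n x - g x| <= \1_(A n) x) ->
  L1_cvg f g.
Proof.
move=> mf ig mA Aa a0 fgA.
have mg : measurable_fun setT g by apply/measurable_EFinP/measurable_int/ig.
have ifg n : leb.-integrable setT (EFin \o (f n \- g)%R).
  apply: (le_integrable measurableT _ _ (integrable_indic_rV (A n) (mA n) _)).
  - by apply/measurable_EFinP; exact: measurable_funB.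
  - by move=> x _; rewrite lee_fin [leRHS]ger0_norm// fgA.
  - by rewrite Aa ltry.
split=> //.
  move=> n; have := integrableD measurableT (ifg n) ig.
  by congr (_.-integrable _ _); apply/funext => x /=; rewrite -EFinD subrK.
apply: (@squeeze_cvge _ _ _ _ (fun=> 0%E) _ (fun n => (a n)%:E)).
- apply: nearW => n; rewrite Lnorm1 integral_ge0//=.
  rewrite -(Aa n) -integral_indic_rV//; apply: integral_le_ge0 => x.
    by rewrite lee_fin.
  by rewrite lee_fin fgA.
- exact: cvg_cst.
- by apply: cvg_EFin => //; exact: nearW.
Qed.

Lemma indic_cube0_neq0 (t : R) : 0 < t ->
  ~ ((\1_(cube t 0) : 'rV[R]_d -> R) = cst 0 %[ae leb]).
Proof.
move=> t0 [N [mN N0 cN]].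
have : (leb (cube t 0) <= leb N)%E.
  apply: le_measure; rewrite ?inE//; first exact: measurable_cube0.
  move=> x xt; apply: cN => /=; rewrite indicE mem_set//= => /(_ I)/eqP.
  by rewrite oner_eq0.
rewrite N0 (lebesgue_cube0 t (ltW t0)) lee_fin leNgt exprn_gt0//.
by rewrite mulr_gt0.
Qed.

Lemma not_cube0 (r : R) (x : 'rV[R]_d) : ~ cube r 0 x ->
  exists i, r < `|x ord0 i|.
Proof.
move=> nx; apply: contrapT => /forallNP H; apply: nx => i.
by rewrite mxE subr0 leNgt; apply/negP; exact: H.
Qed.

Lemma cvg_cube_measure (t : R) :
  (fun n => (2 * (t + n.+1%:R^-1)) ^+ d) @ \oo --> ((2 * t) ^+ d : R).
Proof.
apply: (cvg_comp (fun n => 2 * (t + n.+1%:R^-1)) (fun r : R => r ^+ d));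
  last exact: exprn_continuous.
apply: cvgM; first exact: cvg_cst.
rewrite -[X in _ --> X]addr0; apply: cvgD; first exact: cvg_cst.
exact: cvg_harmonic.
Qed.

Lemma continuous_enorm : continuous (enorm : 'rV[R]_d -> R).
Proof.
move=> x; apply: (@continuous_comp _ _ _ sqnorm Num.sqrt);
  last exact: sqrt_continuous.
move: x; apply: (@continuous_big _ _ +%R 0 xpredT add_continuous) => i _ x.
apply: (@continuous_comp _ _ _ (fun y : 'rV[R]_d => y ord0 i) (fun r => r ^+ 2));
  last exact: exprn_continuous.
exact: coord_continuous.
Qed.

Lemma continuous_hat n : continuous (hat n : 'rV[R]_d -> R).
Proof.
have c1 : continuous (cst 1 \- cst n%:R \* enorm : 'rV[R]_d -> R).
  move=> y; apply: continuousB; first exact: cst_continuous.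
  by apply: continuousM; [exact: cst_continuous|exact: continuous_enorm].
move=> x; apply: (@continuous_max _ _ _ (cst 0) x (c1 x)).
exact: cst_continuous.
Qed.

Lemma hat_le_indic n (r : R) (x : 'rV[R]_d) : (0 < n)%N -> n%:R^-1 <= r ->
  hat n x <= \1_(cube r 0) x.
Proof.
move=> n0 nr; have [xr|/not_cube0[i xi]] := pselect (cube r 0 x).
  by rewrite indicE mem_set//= hat_le1.
by rewrite (hat_eq0 n x i n0)//; apply: le_trans nr (ltW xi).
Qed.

Lemma Cb_hat n : Cb [set: 'rV[R]_d] (hat n).
Proof.
split; first exact/continuous_subspaceT/continuous_hat.
exists 1; split=> [|M M1 x _]; first exact: num_real.
by rewrite /= ger0_norm ?hat_ge0//; apply: le_trans (hat_le1 n x) (ltW M1).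
Qed.

Lemma Linf_int_hat n : (0 < n)%N -> Linf_int (hat n : 'rV[R]_d -> R).
Proof.
move=> n0; have ninv1 : n%:R^-1 <= 1 :> R by rewrite invf_le1 ?ltr0n// ler1n.
have iC (r : R) : ((0 <= r)%R -> \int[leb]_x (\1_(cube r 0) x)%:E < +oo)%E.
  move=> r0; rewrite integral_indic_rV; last exact: measurable_cube0.
  by rewrite lebesgue_cube0// ltry.
split; first split.
  apply: measurable_continuous_rV; exact: continuous_hat.
  move=> K _; rewrite integral_mkcond.
  apply: le_lt_trans (iC 1 ler01); apply: integral_le_ge0 => x.
    by rewrite lee_fin.
  rewrite patchE; case: ifPn => _; last by rewrite lee_fin.
  rewrite lee_fin ger0_norm ?hat_ge0//; exact: hat_le_indic.
apply: le_lt_trans (iC 2 (ler0n R 2)); apply: integral_le_ge0 => x.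
  by rewrite lee_fin.
apply: ereal_inf_lbound; apply: aeW => y xy; rewrite lee_fin ger0_norm ?hat_ge0//.
rewrite indicE; have [x2|/not_cube0[i xi]] := pselect (cube 2 0 x).
  by rewrite mem_set//= hat_le1.
rewrite (hat_eq0 n y i n0)//; apply: le_trans ninv1 _.
have := xy i; have := ler_normB (y ord0 i) (y ord0 i - x ord0 i).
by rewrite opprB addrC subrK; lra.
Qed.

End L1.

(** * Convergence of the initial data and of the solutions *)

Section convergence.
Context {R : realType} {d : nat}.
Local Notation leb := (@lebesgue_rV R d).

Lemma subset_cube0 (r s : R) : r <= s -> cube r 0 `<=` (cube s 0 : set 'rV[R]_d).
Proof. by move=> rs x xr i; exact: le_trans (xr i) rs. Qed.

Lemma lebesgue_cube0D (r s : R) : 0 <= r -> r <= s ->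
  leb (cube s 0 `\` cube r 0) = ((2 * s) ^+ d - (2 * r) ^+ d)%:E.
Proof.
move=> r0 rs; have s0 : 0 <= s by exact: le_trans rs.
have ms := @measurable_cube0 R d s; have mr := @measurable_cube0 R d r.
have ls := @lebesgue_cube0 R d s s0; have lr := @lebesgue_cube0 R d r r0.
rewrite measureD//; last by have := ltry ((2 * s) ^+ d); rewrite -ls.
rewrite setIidr; last exact: subset_cube0.
exact: (congr2 (fun a b => a - b)%E ls lr).
Qed.

(** At a positive time, continuity relative to the closed half-space is plain
    continuity. *)
Lemma continuous_slice (phi : 'rV[R]_d * R -> R) (t : R) : 0 < t ->
  {within halfspace, continuous phi} -> continuous (fun x => phi (x, t)).
Proof.
move=> t0 cphi x.
have oH : open [set z : 'rV[R]_d * R | 0 < z.2].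
  apply: (@open_comp _ _ snd [set r : R | 0 < r]); last exact: open_gt.
  by move=> z _; exact: cvg_snd.
have : {within [set z : 'rV[R]_d * R | 0 < z.2], continuous phi}.
  by apply: continuous_subspaceW cphi => z /ltW.
rewrite continuous_open_subspace// => /(_ (x, t) (mem_set t0)) H.
apply: (@continuous_comp _ _ _ (fun y : 'rV[R]_d => (y, t)) phi).
  by apply: (@cvg_pair _ _ _ (nbhs x) (nbhs x) (nbhs t) _ _ _ id (cst t));
    [exact: cvg_id|exact: cvg_cst].
exact: H.
Qed.

Lemma L1_cvg_hat : (0 < d)%N ->
  L1_cvg (fun n => hat n.+1 : 'rV[R]_d -> R) (cst 0).
Proof.
move=> d0; have ninv0 n : 0 <= n.+1%:R^-1 :> R by rewrite invr_ge0.
apply: (L1_cvg_indic_bound _ _ (fun n => cube n.+1%:R^-1 0)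
  (fun n => (2 * (0 + n.+1%:R^-1)) ^+ d)).
- by move=> n; apply: measurable_continuous_rV; exact: continuous_hat.
- exact: integrable0.
- by move=> n; exact: measurable_cube0.
- by move=> n; rewrite add0r lebesgue_cube0.
- have := @cvg_cube_measure R d 0; rewrite mulr0 expr0n.
  by case: d d0.
- move=> n x; rewrite subr0 ger0_norm ?hat_ge0//; exact: hat_le_indic.
Qed.

Lemma L1_cvg_sol (phi : nat -> 'rV[R]_d * R -> R) (t : R) : 0 < t ->
  (forall n, (1 <= n)%N -> viscosity_solution (hat n) (phi n)) ->
  L1_cvg (fun n x => phi n.+1 (x, t)) (\1_(cube t 0)).
Proof.
move=> t0 sol; have t0' := ltW t0.
have tn n : t <= t + n.+1%:R^-1 by rewrite lerDl invr_ge0.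
apply: (L1_cvg_indic_bound _ _ (fun n => cube (t + n.+1%:R^-1) 0 `\` cube t 0)
  (fun n => (2 * (t + n.+1%:R^-1)) ^+ d - (2 * t) ^+ d)).
- move=> n; apply: measurable_continuous_rV; apply: continuous_slice => //.
  by have [[]] := sol n.+1 isT.
- apply: integrable_indic_rV; first exact: measurable_cube0.
  by rewrite (@lebesgue_cube0 R d t t0') ltry.
- by move=> n; apply: measurableD; exact: measurable_cube0.
- by move=> n; exact: lebesgue_cube0D.
- rewrite -(subrr ((2 * t) ^+ d)); apply: cvgB; last exact: cvg_cst.
  exact: cvg_cube_measure.
(* On the cube of half-side t both functions are 1, and outside the cube of
   half-side t + 1 / (n + 1) both are 0. *)
- move=> n x; have soln := sol n.+1 isT.
  have [xt|nxt] := pselect (cube t 0 x).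
    rewrite (sol_eq1 n.+1 _ soln x t t0); last first.
      by move=> i; have := xt i; rewrite mxE subr0.
    by rewrite indicE mem_set// subrr normr0.
  rewrite [\1_(cube t 0) x]indicE memNset// subr0.
  rewrite ger0_norm; last exact: (sol_ge0 n.+1).
  have [xn|/not_cube0[i xi]] := pselect (cube (t + n.+1%:R^-1) 0 x).
    rewrite indicE mem_set//=; exact: (sol_le1 n.+1).
  by rewrite (sol_eq0 n.+1 _ soln i x t isT t0' xi).
Qed.

End convergence.

Theorem proposition28 (R : realType) (d : nat) (d_gt0 : (0 < d)%N)
    (phi : nat -> 'rV[R]_d * R -> R)
    (phi_sol : forall n, (1 <= n)%N -> viscosity_solution (hat n) (phi n)) :
  [/\ forall n, (1 <= n)%N ->
        Cb [set: 'rV[R]_d] (hat n) /\ Linf_int (hat n : 'rV[R]_d -> R),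
      L1_cvg (fun n => hat n.+1 : 'rV[R]_d -> R) (cst 0) &
      forall t : R, 0 < t ->
        L1_cvg (fun n x => phi n.+1 (x, t)) (\1_(cube t 0) : 'rV[R]_d -> R) /\
        ~ ((\1_(cube t 0) : 'rV[R]_d -> R) = cst 0 %[ae lebesgue_rV d])].
Proof.
split=> [n n1||t t0].
- by split; [exact: Cb_hat|exact: Linf_int_hat].
- exact: L1_cvg_hat.
- by split; [exact: L1_cvg_sol|exact: indic_cube0_neq0].
Qed.
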